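(* Let $\mathcal{G}$ be a compact group acting continuously on a sample space $\mathcal{Y}$. For each orbit $O \in \mathcal{Y}/\mathcal{G}$ let $K_O : F_+^O \to [0,\infty]$ be an orbit-level objective, let $\Psi : [0,\infty]^{\mathcal{Y}/\mathcal{G}} \to [0,\infty]$ be non-decreasing in its inputs (if $a_O \leq b_O$ for all $O$, then $\Psi((a_O)_O) \leq \Psi((b_O)_O)$), and define the aggregate objective $K : F_+^{\mathcal{Y}} \to [0,\infty]$ by $$K(f) = \Psi\big((K_O(f_{|O}))_{O \in \mathcal{Y}/\mathcal{G}}\big).$$ Let $\varepsilon^* \in F_+^{\mathcal{Y}}$ and suppose that for each $O \in \mathcal{Y}/\mathcal{G}$: (i) $\varepsilon^*_{|O}$ is a valid e-value for $\mathrm{Unif}(O)$; (ii) $K_O(\varepsilon^*_{|O}) \geq K_O(\varepsilon)$ for every e-value $\varepsilon \in F_+^O$ that is valid for $\mathrm{Unif}(O)$. Then $\varepsilon^*$ is valid for $\mathcal{G}$ invariance and $K$-optimal: $K(\varepsilon^* ) \geq K(\varepsilon)$ for every e-value $\varepsilon \in F_+^{\mathcal{Y}}$ that is valid for $\mathcal{G}$ invariance.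
   Context: All spaces are second-countable locally compact Hausdorff, equipped with their Borel $\sigma$-algebras. $F_+^{\mathcal{A}}$ denotes the set of $[0,\infty]$-valued measurable functions on a space $\mathcal{A}$, and $f_{|\mathcal{B}}$ is the restriction of $f$ to a measurable subspace $\mathcal{B}$. The orbit of $y$ is $O_y = \{Gy : G \in \mathcal{G}\}$, and $\mathcal{Y}/\mathcal{G}$ is the set of orbits. $\mathrm{Unif}(O)$ is the law of $\overline{G}y$ for any $y \in O$, where $\overline{G}$ follows the Haar probability measure on $\mathcal{G}$. An e-value $\varepsilon$ is valid for a probability $\mathbb{P}$ if $\mathbb{E}^{\mathbb{P}}[\varepsilon] \leq 1$; it is valid for $\mathcal{G}$ invariance if this holds for every $\mathcal{G}$ invariant probability $\mathbb{P}$ on $\mathcal{Y}$ (i.e. $\mathbb{P}(G^{-1}A) = \mathbb{P}(A)$ for all $G \in \mathcal{G}$ and events $A$). *)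

(* Defs.v *)
From HB Require Import structures.
From mathcomp Require Import all_boot all_order all_algebra.
From mathcomp Require Import all_classical all_reals all_analysis.
From mathcomp Require Import measurable_realfun.

Set Implicit Arguments.
Unset Strict Implicit.
Unset Printing Implicit Defensive.

Import Order.TTheory GRing.Theory Num.Theory.

Local Open Scope classical_set_scope.
Local Open Scope ring_scope.
Local Open Scope ereal_scope.

(* Measurable types are pointed in the library, whence [ptopologicalType]
   rather than [topologicalType] throughout. *)
Definition lcsc_hausdorff (T : ptopologicalType) : Prop :=
  [/\ @second_countable T, locally_compact [set: T] & hausdorff_space T].

Notation borel T := (g_sigma_algebraType (@open T)).

Lemma continuous_borel_measurable (T U : ptopologicalType) (f : T -> U) :
  continuous f -> measurable_fun [set: borel T] (f : borel T -> borel U).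
Proof.
move=> /continuousP cf; apply: (@measurability _ _ (borel T) (borel U) _ _ (@open U) erefl).
by move=> _ [B oB <-]; rewrite setTI; apply: sub_sigma_algebra; exact: cf.
Qed.

(* The multiplicative analogue of [topologicalZmodType]. *)
HB.mixin Record isTopGroup G & PointedTopological G & Group G := {
  mulg_continuous : continuous (fun x : G * G => (x.1 * x.2)%g);
  invg_continuous : continuous (fun x : G => (x^-1)%g)
}.

#[short(type="topGroupType")]
HB.structure Definition TopGroup :=
  {G of PointedTopological G & Group G & isTopGroup G}.

Record continuous_action (G : topGroupType) (Y : ptopologicalType) := {
  act :> G -> Y -> Y;
  act1 : forall y, act 1%g y = y;
  actM : forall g h y, act (g * h)%g y = act g (act h y);
  act_continuous : continuous (fun x : G * Y => act x.1 x.2)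
}.

Section orbits.
Context {G : topGroupType} {Y : ptopologicalType}.
Variable a : continuous_action G Y.

Definition orbit (y : Y) : set Y := [set a g y | g in [set: G]].

Record orbit_space := Orbit {
  orbit_set :> set Y;
  orbit_setP : exists y, orbit_set = orbit y
}.

Lemma orbit_refl (y : Y) : orbit y y.
Proof. by exists 1%g => //; rewrite act1. Qed.

Lemma orbit_inhabited (O : orbit_space) : exists y : Y, y \in (O : set Y).
Proof.
by case: O => O /= [y ->]; exists y; apply/mem_set; exact: orbit_refl.
Qed.

Lemma orbit_act (O : orbit_space) (g : G) (y : Y) :
  y \in (O : set Y) -> a g y \in (O : set Y).
Proof.
case: O => O /= [z ->]; rewrite !inE => -[h _ <-].
by exists (g * h)%g => //; rewrite actM.
Qed.

(* An orbit as a topological space in its own right, with the subspace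
   topology (the one of [set_type]). *)
Definition orbit_sub (O : orbit_space) : Type := set_type (orbit_set O).

HB.instance Definition _ (O : orbit_space) :=
  Topological.copy (orbit_sub O) (set_type (orbit_set O)).
HB.instance Definition _ (O : orbit_space) :=
  isPointed.Build (orbit_sub O)
    (exist _ (sval (cid (orbit_inhabited O))) (svalP (cid (orbit_inhabited O)))).

Definition orbit_incl (O : orbit_space) (y : orbit_sub O) : Y := sval y.

Lemma orbit_incl_continuous (O : orbit_space) : continuous (@orbit_incl O).
Proof. exact: (@initial_continuous (orbit_sub O) Y (@orbit_incl O)). Qed.

Definition orbit_map (O : orbit_space) (y : orbit_sub O) (g : G) :
  orbit_sub O := exist _ (a g (sval y)) (orbit_act g (svalP y)).

Lemma orbit_map_continuous (O : orbit_space) (y : orbit_sub O) :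
  continuous (orbit_map y).
Proof.
apply/continuousP => _ [/= B oB <-].
rewrite -comp_preimage.
have /continuousP : continuous (fun g : G => a g (sval y)).
  move=> g; apply: (@continuous_comp _ _ _ (fun g : G => (g, sval y))
    (fun x : G * Y => a x.1 x.2)); last exact: act_continuous.
  by apply: cvg_pair; [exact: cvg_id|exact: cvg_cst].
by move=> /(_ _ oB).
Qed.

End orbits.

Section fplus.
Variable R : realType.

Record Fplus (T : ptopologicalType) := {
  fplus_fun :> T -> \bar R;
  fplus_ge0 : forall x, 0 <= fplus_fun x;
  fplus_measurable : measurable_fun [set: borel T] (fplus_fun : borel T -> \bar R)
}.

Section restriction.
Context {G : topGroupType} {Y : ptopologicalType} (a : continuous_action G Y).
Variables (f : Fplus Y) (O : orbit_space a).

Let fO : orbit_sub O -> \bar R := f \o @orbit_incl _ _ a O.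

Let fO_ge0 x : 0 <= fO x. Proof. exact: fplus_ge0. Qed.

Let fO_measurable : measurable_fun [set: borel (orbit_sub O)] fO.
Proof.
apply: (measurableT_comp (fplus_measurable f)).
exact: (continuous_borel_measurable (@orbit_incl_continuous _ _ a O)).
Qed.

Definition restrict_orbit : Fplus (orbit_sub O) :=
  {| fplus_fun := fO; fplus_ge0 := fO_ge0; fplus_measurable := fO_measurable |}.

End restriction.

Definition valid_for (T : ptopologicalType) (P : probability (borel T) R)
    (e : Fplus T) : Prop :=
  \int[P]_x e x <= 1.

Section invariance.
Context {G : topGroupType} {Y : ptopologicalType} (a : continuous_action G Y).

Definition invariant_probability (P : probability (borel Y) R) : Prop :=
  forall (g : G) (A : set (borel Y)), measurable A -> P (a g @^-1` A) = P A.

Definition valid_for_invariance (e : Fplus Y) : Prop :=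
  forall P : probability (borel Y) R, invariant_probability P -> valid_for P e.

End invariance.

(* Left invariance; on a second-countable compact group this determines a
   unique Borel probability, regularity being automatic. *)
Definition haar_probability (G : topGroupType) (mu : probability (borel G) R) :
    Prop :=
  forall (g : G) (A : set (borel G)), measurable A ->
    mu ((fun h : G => (g * h)%g) @^-1` A) = mu A.

Section uniform.
Context {G : topGroupType} {Y : ptopologicalType} (a : continuous_action G Y).
Variables (mu : probability (borel G) R) (O : orbit_space a).

Definition orbit_mfun (y : orbit_sub O) : borel G -> borel (orbit_sub O) :=
  orbit_map y.

HB.instance Definition _ (y : orbit_sub O) :=
  isMeasurableFun.Build _ _ _ _ (orbit_mfun y)
    (continuous_borel_measurable (@orbit_map_continuous _ _ a O y)).

(* The law of [g y], [g] distributed as [mu], for the distinguished point [y]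
   of [O]. When [mu] is the Haar probability of a compact group (which is also
   right invariant) the law is the same for all [y] in [O]. *)
Definition unif : probability (borel (orbit_sub O)) R :=
  distribution mu (orbit_mfun (point : orbit_sub O)).

End uniform.

Definition aggregate {G : topGroupType} {Y : ptopologicalType}
    (a : continuous_action G Y)
    (Psi : (orbit_space a -> {nonneg \bar R}) -> {nonneg \bar R})
    (KO : forall O : orbit_space a, Fplus (orbit_sub O) -> {nonneg \bar R})
    (f : Fplus Y) : {nonneg \bar R} :=
  Psi (fun O => KO O (restrict_orbit f O)).

End fplus.

(* Main.v *)
From HB Require Import structures.
Require Import Defs.
From mathcomp Require Import all_boot all_order all_algebra.
From mathcomp Require Import all_classical all_reals all_analysis.
From mathcomp Require Import measurable_realfun.

Local Open Scope classical_set_scope.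
Local Open Scope ring_scope.
Local Open Scope ereal_scope.

(** An invariant probability is a mixture of the uniform laws on the orbits,
    and each of these uniform laws, seen as a law on the whole space, is itself
    invariant. Hence an e-value is valid for invariance if and only if its
    restriction to every orbit is valid for the uniform law of that orbit, and
    the theorem follows from this equivalence: the restrictions of any
    competitor are valid competitors on the orbits, so they do no better on any
    orbit, and the monotonicity of the aggregation does the rest.

    The mixture is obtained by averaging (integral_invariant_average): for an
    invariant law [P] of [y], the integral of [e y] equals that of [e (a g y)]
    for every [g], hence also its average over Haar-distributed [g]. After
    exchanging the two integrals, the inner one is the integral of [e] over the
    uniform law of the orbit of [y] (integral_unif_orbit). Two facts are behind
    this argument.
    - Tonelli's theorem speaks of the product of the Borel sigma-algebras,
      while continuity of the action gives Borel measurability for the product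
      topology; second countability reconciles the two
      (open_prod_measurable).
    - The uniform law of an orbit is defined from one chosen point of it.
      Independence of this choice is the right invariance of the Haar
      probability, which is assumed to be left invariant only. It is derived
      in haar_integral_mulgr from invariance under inversion. *)

(** * Measurability on products of second-countable spaces *)

(** An open set of the product is a union of rectangles whose sides belong to
    the countable bases, and there are only countably many such rectangles. *)
Lemma open_prod_measurable {T U : ptopologicalType} (W : set (T * U)) :
  @second_countable T -> @second_countable U -> open W ->
  measurable (W : set (borel T * borel U)%type).
Proof.
move=> [B cB [Bo Bb]] [C cC [Co Cb]] oW.
pose D := [set BC | (B `*` C) BC /\ BC.1 `*` BC.2 `<=` W].
have -> : W = \bigcup_(BC in D) (BC.1 `*` BC.2).
  apply/seteqP; split => [[x y] Wxy|z [BC [_]] sub]; last exact: sub.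
  have [[V V'] /= [Vx V'y] sub] : nbhs (x, y) W by exact: open_nbhs_nbhs.
  have [V1 [BV1 V1x] sub1] := Bb x V Vx.
  have [V2 [CV2 V2y] sub2] := Cb y V' V'y.
  exists (V1, V2) => //; split => //= -[u v] [/= V1u V2v].
  by apply: sub; split; [exact: sub1|exact: sub2].
rewrite bigcup_set_type; apply: countable_bigcupT_measurable => [|[BC /=]].
  rewrite (eq_countable (card_setT D)).
  by apply: sub_countable (countableX cB cC); apply: subset_card_le => ? [].
rewrite inE => -[[BBC CBC] _].
by apply: measurableX; apply: sub_sigma_algebra; [exact: Bo|exact: Co].
Qed.

Lemma continuous_prod_measurable {T U V : ptopologicalType} (f : T * U -> V) :
  @second_countable T -> @second_countable U -> continuous f ->
  measurable_fun [set: borel T * borel U] (f : borel T * borel U -> borel V).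
Proof.
move=> sT sU /continuousP cf.
apply: (@measurability _ _ (borel T * borel U)%type (borel V) _ _
  (@open V) erefl) => _ [B oB <-].
by rewrite setTI; apply: open_prod_measurable => //; exact: cf.
Qed.

Lemma section1_measurable {T U V : ptopologicalType} {f : T * U -> V} (y : U) :
  continuous f ->
  measurable_fun [set: borel T] ((fun x => f (x, y)) : borel T -> borel V).
Proof.
move=> cf; apply: continuous_borel_measurable => x.
apply: (@continuous_comp _ _ _ (fun x : T => (x, y)) f); last exact: cf.
by apply: cvg_pair; [exact: cvg_id|exact: cvg_cst].
Qed.

Lemma section2_measurable {T U V : ptopologicalType} {f : T * U -> V} (x : T) :
  continuous f ->
  measurable_fun [set: borel U] ((fun y => f (x, y)) : borel U -> borel V).
Proof.
move=> cf; apply: continuous_borel_measurable => y.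
apply: (@continuous_comp _ _ _ (fun y : U => (x, y)) f); last exact: cf.
by apply: cvg_pair; [exact: cvg_cst|exact: cvg_id].
Qed.

(** * Integrals against invariant probabilities *)

Lemma probability_integral_cst {d} {T : measurableType d} {R : realType}
    (P : probability T R) (c : \bar R) : \int[P]_x c = c.
Proof.
rewrite (integral_cst P)//.
rewrite -[RHS]mule1; congr (_ * _); exact: probability_setT.
Qed.

Lemma ge0_integral_invariant {d} {T : measurableType d} {R : realType}
    (P : probability T R) (f : T -> T) (e : T -> \bar R) :
  measurable_fun [set: T] f ->
  (forall A, measurable A -> P (f @^-1` A) = P A) ->
  measurable_fun [set: T] e -> (forall x, 0 <= e x) ->
  \int[P]_x e (f x) = \int[P]_x e x.
Proof.
move=> mf Pf me e0.
have fM : isMeasurableFun _ _ _ _ f by constructor.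
pose F : {mfun T >-> T} := HB.pack f fM.
rewrite -[RHS](@eq_measure_integral _ _ _ _ P (pushforward P F)); last first.
  by move=> A mA _; exact: Pf.
by rewrite ge0_integral_pushforward// => x _.
Qed.

(** * Haar probabilities are invariant under inversion and right translations *)

Section haar.
Context {R : realType} {G : topGroupType} (mu : probability (borel G) R).
Hypotheses (sG : @second_countable G) (mu_haar : haar_probability mu).
Implicit Types (phi : borel G -> \bar R) (k : G).

Lemma mulgl_measurable k :
  measurable_fun [set: borel G] ((fun g => (k * g)%g) : borel G -> borel G).
Proof. exact: (section2_measurable _ mulg_continuous). Qed.

Lemma invg_measurable :
  measurable_fun [set: borel G] ((fun g => (g^-1)%g) : borel G -> borel G).
Proof. by apply: continuous_borel_measurable; exact: invg_continuous. Qed.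

Lemma mulg_measurable : measurable_fun [set: borel G * borel G]
  ((fun x => (x.1 * x.2)%g) : borel G * borel G -> borel G).
Proof. by apply: continuous_prod_measurable => //; exact: mulg_continuous. Qed.

Lemma haar_integral_mulgl phi k :
  measurable_fun setT phi -> (forall g, 0 <= phi g) ->
  \int[mu]_g phi (k * g)%g = \int[mu]_g phi g.
Proof.
move=> mphi phi0; apply: (ge0_integral_invariant mu (fun g => (k * g)%g)) => //.
- exact: mulgl_measurable.
- exact: mu_haar.
Qed.

(** Integrating [phi (g^-1 * h)] over both variables gives the integral of
    [phi] when [h] is integrated first, and that of [phi (g^-1)] when [g] is
    integrated first: in the latter case the integrand is a function of
    [h^-1 * g]. Tonelli's theorem identifies the two. *)
Lemma haar_integral_invg phi :
  measurable_fun setT phi -> (forall g, 0 <= phi g) ->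
  \int[mu]_g phi (g^-1)%g = \int[mu]_g phi g.
Proof.
move=> mphi phi0.
have mphiV : measurable_fun [set: borel G] (fun g => phi (g^-1)%g).
  by apply: (measurableT_comp mphi); exact: invg_measurable.
have -> : \int[mu]_g phi g = \int[mu]_g \int[mu]_h phi (g^-1 * h)%g.
  rewrite -[LHS](probability_integral_cst mu); apply: eq_integral => g _.
  by rewrite haar_integral_mulgl.
rewrite (fubini_tonelli
  (fun x : borel G * borel G => phi (x.1^-1 * x.2)%g)) //=; last first.
  apply: (measurableT_comp mphi).
  apply: (measurableT_comp mulg_measurable
    (g := fun x : borel G * borel G => ((x.1^-1)%g, x.2) : borel G * borel G)).
  apply: measurable_fun_pair => //.
  exact: (measurableT_comp invg_measurable).
rewrite -[LHS](probability_integral_cst mu); apply: eq_integral => h _.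
rewrite -(haar_integral_mulgl (fun g => phi (g^-1)%g) (h^-1)%g) //.
by apply: eq_integral => g _; rewrite invgM invgK.
Qed.

(** Inversion turns a right translation into a left one. *)
Lemma haar_integral_mulgr phi k :
  measurable_fun setT phi -> (forall g, 0 <= phi g) ->
  \int[mu]_g phi (g * k)%g = \int[mu]_g phi g.
Proof.
move=> mphi phi0.
rewrite -haar_integral_invg //; last first.
  apply: (measurableT_comp mphi).
  exact: (section1_measurable _ mulg_continuous).
rewrite -[RHS]haar_integral_invg // -[RHS](haar_integral_mulgl _ (k^-1)%g) //.
  by apply: eq_integral => g _; rewrite invgM invgK.
by apply: (measurableT_comp mphi); exact: invg_measurable.
Qed.

End haar.

(** * Validity for invariance is validity on every orbit *)

Section orbits.
Context {R : realType} {G : topGroupType} {Y : ptopologicalType}.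
Variables (a : continuous_action G Y) (mu : probability (borel G) R).
Hypotheses (sG : @second_countable G) (sY : @second_countable Y).
Hypothesis mu_haar : haar_probability mu.
Implicit Types (e : Fplus R Y) (y : Y) (O : orbit_space a).

Lemma act_point_measurable y :
  measurable_fun [set: borel G] ((a^~ y) : borel G -> borel Y).
Proof. exact: (section1_measurable _ (@act_continuous _ _ a)). Qed.

Lemma act_measurable (g : G) :
  measurable_fun [set: borel Y] ((a g) : borel Y -> borel Y).
Proof. exact: (section2_measurable _ (@act_continuous _ _ a)). Qed.

Lemma integral_unif_restrict e O :
  \int[unif mu O]_x restrict_orbit e O x =
  \int[mu]_g e (a g (orbit_incl (point : orbit_sub O))).
Proof.
rewrite ge0_integral_pushforward //=.
  exact: (fplus_measurable (restrict_orbit e O)).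
by move=> x _; exact: fplus_ge0.
Qed.

(** If [p] is the point of [O] that defines the uniform law, then
    [p = a k y] for some [k], so that the two laws of [a g p] and [a g y] differ
    by a right translation of the Haar-distributed [g]. *)
Lemma integral_unif_orbit e O y : (O : set Y) y ->
  \int[unif mu O]_x restrict_orbit e O x = \int[mu]_g e (a g y).
Proof.
move=> Oy; rewrite integral_unif_restrict.
have [k ->] : exists k : G, orbit_incl (point : orbit_sub O) = a k y.
  have : (O : set Y) (orbit_incl (point : orbit_sub O)).
    by apply/set_mem; exact: (svalP (point : orbit_sub O)).
  have [z Oz] := orbit_setP O; move: Oy; rewrite Oz => -[h _ <-] [k _ <-].
  by exists (k * h^-1)%g; rewrite -actM mulgVK.
under eq_integral do rewrite -actM.
apply: (haar_integral_mulgr mu sG mu_haar (fun g => e (a g y)) k).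
  exact: (measurableT_comp (fplus_measurable e) (act_point_measurable y)).
by move=> g; exact: fplus_ge0.
Qed.

Lemma action_integrand_measurable e :
  measurable_fun [set: borel Y * borel G] (fun x => e (a x.2 x.1)).
Proof.
apply: (measurableT_comp (fplus_measurable e)).
apply: continuous_prod_measurable => // x.
apply: (@continuous_comp _ _ _ (fun x : Y * G => (x.2, x.1))
  (fun x : G * Y => a x.1 x.2)); last exact: act_continuous.
by apply: cvg_pair; [exact: cvg_snd|exact: cvg_fst].
Qed.

(** For each fixed [g] the law [P] is unchanged by [a g], so averaging over
    [g] changes nothing either; exchanging the integrals puts the average over
    the group inside, where it becomes an average over a single orbit. *)
Lemma integral_invariant_average (P : probability (borel Y) R) e :
  invariant_probability a P ->
  \int[P]_y e y = \int[P]_y \int[mu]_g e (a g y).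
Proof.
move=> Pinv.
rewrite (fubini_tonelli
  (fun x : borel Y * borel G => e (a x.2 x.1))) //=; last first.
- by move=> x; exact: fplus_ge0.
- exact: action_integrand_measurable.
transitivity (\int[mu]_g \int[P]_y e y).
  by rewrite probability_integral_cst.
apply: eq_integral => g _; apply/esym.
apply: ge0_integral_invariant.
- exact: act_measurable.
- exact: Pinv.
- exact: fplus_measurable.
- exact: fplus_ge0.
Qed.

(** The inner integral of the averaged form is, at each [y], the expectation
    of [e] on the orbit of [y], hence at most 1. *)
Lemma valid_for_invariance_of_orbits e :
  (forall O, valid_for (unif mu O) (restrict_orbit e O)) ->
  valid_for_invariance a e.
Proof.
move=> eO P Pinv; rewrite /valid_for integral_invariant_average //.
apply: (@Order.POrderTheory.le_trans _ _ (\int[P]_y 1)); last first.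
  by rewrite probability_integral_cst.
apply: ge0_le_integral => //.
- by move=> y _; apply: integral_ge0 => g _; exact: fplus_ge0.
- apply: (measurable_fun_fubini_tonelli_F
    (fun x : borel Y * borel G => e (a x.2 x.1))) => [|x].
    exact: action_integrand_measurable.
  exact: fplus_ge0.
- move=> y _; have [Q Qy] : exists O : orbit_space a, (O : set Y) y.
    exists (Orbit (ex_intro (fun z => Defs.orbit a y = Defs.orbit a z) y erefl)).
    exact: orbit_refl.
  by rewrite -(integral_unif_orbit e Q y Qy); exact: eO.
Qed.

(** The uniform law of [O], pushed to the whole space, is the law of [a g p]
    for a point [p] of [O]; it is invariant because the Haar probability is
    left invariant. Validity of [e] can therefore be tested against it. *)
Lemma valid_for_orbits_of_invariance e O :
  valid_for_invariance a e -> valid_for (unif mu O) (restrict_orbit e O).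
Proof.
move=> ev; rewrite /valid_for integral_unif_restrict.
set p := orbit_incl _; have mp := act_point_measurable p.
have pM : isMeasurableFun _ _ (borel G) (borel Y) (a^~ p) by constructor.
pose F : {mfun borel G >-> borel Y} :=
  HB.pack ((a^~ p) : borel G -> borel Y) pM.
have := ev (distribution mu F).
rewrite /valid_for ge0_integral_pushforward //=; last 2 first.
- exact: fplus_measurable.
- by move=> x _; exact: fplus_ge0.
apply => g A mA; rewrite /distribution /pushforward -[RHS](mu_haar g).
  by congr (mu _); apply/seteqP; split => h /=; rewrite actM.
by rewrite -[X in measurable X]setTI; exact: mp.
Qed.

End orbits.

Theorem theorem5 (R : realType) (G : topGroupType) (Y : ptopologicalType)
    (G_space : lcsc_hausdorff G) (G_compact : compact [set: G])
    (Y_space : lcsc_hausdorff Y)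
    (a : continuous_action G Y)
    (mu : probability (borel G) R) (mu_haar : haar_probability mu)
    (KO : forall O : orbit_space a, Fplus R (orbit_sub O) -> {nonneg \bar R})
    (Psi : (orbit_space a -> {nonneg \bar R}) -> {nonneg \bar R})
    (Psi_mono : forall u v : orbit_space a -> {nonneg \bar R},
      (forall O, (u O)%:num <= (v O)%:num) -> (Psi u)%:num <= (Psi v)%:num)
    (estar : Fplus R Y)
    (estar_valid : forall O : orbit_space a,
      valid_for (unif mu O) (restrict_orbit estar O))
    (estar_opt : forall (O : orbit_space a) (e : Fplus R (orbit_sub O)),
      valid_for (unif mu O) e ->
      (KO O e)%:num <= (KO O (restrict_orbit estar O))%:num) :
  valid_for_invariance a estar /\
  (forall e : Fplus R Y, valid_for_invariance a e ->
    (aggregate Psi KO e)%:num <= (aggregate Psi KO estar)%:num).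
Proof.
have [sG _ _] := G_space; have [sY _ _] := Y_space.
split; first exact: valid_for_invariance_of_orbits sG sY mu_haar _ estar_valid.
move=> e e_valid; apply: Psi_mono => O; apply: estar_opt.
exact: valid_for_orbits_of_invariance.
Qed.
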